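(* Let $m,n,q\in\mathbb N$, $h_1,\dots,h_q\in\mathbb N$, $h=h_1+\cdots+h_q$. Let $A\in\mathbb C^{m\times n}$, let $C_j\in\mathbb C^{h_j\times n}$ for $j=1,\dots,q$, and let $C\in\mathbb C^{h\times n}$ be the matrix obtained by stacking $C_1,\dots,C_q$ as block rows (in this order). Let the matrices $C_r^{(r-1)}\in\mathbb C^{h_r\times n}$ ($r=1,\dots,q$) and $F=F_{q-1}\cdots F_1\in\mathbb C^{h\times h}$ be those produced from $C$ by the block reduction described in the context. For $r=1,\dots,q$ let $D_{C,rr}=C_r^{(r-1)}[C_r^{(r-1)}]^*$, and define the block diagonal matrices $$D_C=\operatorname{diag}[D_{C,11},\dots,D_{C,qq}],\qquad D_C^\dagger=\operatorname{diag}[D_{C,11}^\dagger,\dots,D_{C,qq}^\dagger].$$ Then the matrix $$Y_+=AC^*F^*D_C^\dagger F\in\mathbb C^{m\times h}$$ satisfies $Y_+CC^*=AC^*$, and hence also satisfies $$\|A-Y_+C\|_F=\min_{Y\in\mathbb C^{m\times h}}\|A-YC\|_F .$$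
   Context: $M^*$ denotes the conjugate transpose, $M^\dagger$ the Moore–Penrose inverse, and $\|\cdot\|_F$ the Frobenius norm. Block reduction of $C$: set $C_j^{(0)}=C_j$ for $j=1,\dots,q$. For $r=1,\dots,q-1$ successively, and for $j=r+1,\dots,q$, set $$C_j^{(r)}=C_j^{(r-1)}\left(I-[C_r^{(r-1)}]^\dagger C_r^{(r-1)}\right).$$ For $r=1,\dots,q-1$, $F_r\in\mathbb C^{h\times h}$ is the block lower triangular matrix, partitioned conformally with $h=h_1+\cdots+h_q$, whose diagonal blocks are identity matrices, whose $(j,r)$ block is $-C_j^{(r-1)}[C_r^{(r-1)}]^\dagger$ for each $j=r+1,\dots,q$, and whose other off-diagonal blocks are zero. Finally $F=F_{q-1}\cdots F_1$ (the identity if $q=1$). *)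

(* Defs.v *)
(* Definitions are given over any numClosedFieldType; the complex numbers are
   its instance R[i] for R : realType. *)
From mathcomp Require Export all_boot all_order all_algebra.
From mathcomp Require Export complex reals.

Set Implicit Arguments.
Unset Strict Implicit.
Unset Printing Implicit Defensive.

Import Order.TTheory GRing.Theory Num.Theory.
Local Open Scope ring_scope.
Local Open Scope sesquilinear_scope.

Section MoorePenrose.
Variable K : numClosedFieldType.

Definition penrose m n (M : 'M[K]_(m, n)) (X : 'M[K]_(n, m)) : bool :=
  [&& M *m X *m M == M, X *m M *m X == X,
      (M *m X)^t* == M *m X & (X *m M)^t* == X *m M].

Lemma ctrmx_mul m n p (A : 'M[K]_(m, n)) (B : 'M[K]_(n, p)) :
  (A *m B)^t* = B^t* *m A^t*.
Proof. by rewrite trmx_mul map_mxM. Qed.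

Lemma ctrmx_inv n (A : 'M[K]_n) : (invmx A)^t* = invmx (A^t*).
Proof. by rewrite trmx_inv map_invmx. Qed.

Lemma mulmx_ctrmx_eq0 m n (A : 'M[K]_(m, n)) : (A *m A^t* == 0) = (A == 0).
Proof.
apply/eqP/eqP => [A0|->]; last by rewrite mul0mx.
apply/matrixP => i j; rewrite !mxE; apply/eqP.
have /eqP := congr1 (fun M : 'M_m => M i i) A0; rewrite !mxE.
rewrite psumr_eq0 => [|k _]; last by rewrite !mxE mul_conjC_ge0.
by move=> /allP/(_ j); rewrite mem_index_enum !mxE mul_conjC_eq0 => /(_ isT).
Qed.

Lemma row_free_gram m n (A : 'M[K]_(m, n)) : row_free A -> A *m A^t* \in unitmx.
Proof.
move=> fA; rewrite -row_free_unit -kermx_eq0.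
rewrite -(inj_eq (row_free_inj fA)) mul0mx -mulmx_ctrmx_eq0 ctrmx_mul.
by rewrite mulmxA -(mulmxA _ A) mulmx_ker mul0mx.
Qed.

(* Existence by full-rank factorisation M = L *m U. *)
Lemma penrose_exists m n (M : 'M[K]_(m, n)) : exists X, penrose M X.
Proof.
have EM := esym (mulmx_base M).
have fU := row_base_free M; have fL := col_base_full M.
move: (\rank M) (col_base M) (row_base M) EM fU fL => k L U EM fU fL.
have uU : U *m U^t* \in unitmx by rewrite row_free_gram.
have uL : L^t* *m L \in unitmx.
  have /row_free_gram : row_free (L^t*).
    by rewrite /row_free mxrank_map mxrank_tr.
  by rewrite trmxCK.
pose X := U^t* *m invmx (U *m U^t*) *m (invmx (L^t* *m L) *m L^t*).
have MX : M *m X = L *m (invmx (L^t* *m L) *m L^t*).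
  by rewrite EM /X -!mulmxA (mulmxA U) (mulmxA (U *m _)) mulmxV // mul1mx.
have XM : X *m M = U^t* *m invmx (U *m U^t*) *m U.
  by rewrite EM /X -!mulmxA (mulmxA (L^t*)) (mulmxA (invmx (L^t* *m L))) mulVmx
       // mul1mx.
exists X; apply/and4P; split; apply/eqP.
- rewrite MX {1}EM -!mulmxA (mulmxA (L^t*)) (mulmxA (invmx _)) mulVmx //.
  by rewrite mul1mx -EM.
- rewrite XM /X -!mulmxA (mulmxA U) (mulmxA (invmx (U *m _)) (U *m _)).
  by rewrite mulVmx // mul1mx.
- by rewrite MX !ctrmx_mul ctrmx_inv ctrmx_mul trmxCK mulmxA.
- by rewrite XM !ctrmx_mul ctrmx_inv ctrmx_mul trmxCK mulmxA.
Qed.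

(* The Moore-Penrose inverse; mxalgebra's [pinvmx] is only some generalised
   inverse. *)
Definition mpinv m n (M : 'M[K]_(m, n)) : 'M[K]_(n, m) :=
  xchoose (penrose_exists M).

Lemma mpinvP m n (M : 'M[K]_(m, n)) : penrose M (mpinv M).
Proof. exact: xchooseP. Qed.

Lemma penrose_uniq m n (M : 'M[K]_(m, n)) X Y :
  penrose M X -> penrose M Y -> X = Y.
Proof.
move=> /and4P[/eqP X1 /eqP X2 /eqP X3 /eqP X4].
move=> /and4P[/eqP Y1 /eqP Y2 /eqP Y3 /eqP Y4].
have EL : M *m X = M *m Y.
  by rewrite -X3 -{1}Y1 -mulmxA ctrmx_mul X3 Y3 mulmxA X1.
have ER : X *m M = Y *m M.
  by rewrite -X4 -{1}Y1 -mulmxA mulmxA ctrmx_mul X4 Y4 -mulmxA (mulmxA M) X1.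
by rewrite -X2 -mulmxA EL mulmxA ER Y2.
Qed.

(* Written in K, but its values are nonnegative reals, on which the order of K
   is the usual one. *)
Definition frobenius m n (M : 'M[K]_(m, n)) : K :=
  sqrtC (\sum_i \sum_j `|M i j| ^+ 2).

End MoorePenrose.

Section BlockReduction.
Variables (K : numClosedFieldType) (n q : nat) (h : 'I_q -> nat).
Implicit Types (C : forall j, 'M[K]_(h j, n)) (r : 'I_q).

(* Blocks are numbered from 0, so the pivot of step r.+1 is block r, and the
   final form of block r is [reduced C r r].  Blocks up to the pivot, which the
   reduction never uses again, are left unchanged. *)
Definition reduce_step r C : forall j, 'M[K]_(h j, n) :=
  fun j => if (r < j)%N then C j *m (1%:M - mpinv (C r) *m C r) else C j.

Fixpoint reduced C (k : nat) : forall j, 'M[K]_(h j, n) :=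
  if k is k'.+1 then
    if insub k' is Some r then reduce_step r (reduced C k') else reduced C k'
  else C.

Definition pivot C r : 'M[K]_(h r, n) := reduced C r r.

(* Column r is written with [reduced C r j] under the guard j == r, which
   avoids a cast of the block dimensions. *)
Definition elim_mx C r : 'M[K]_(\sum_i h i) :=
  1%:M - \mxblock_(i, j)
    (if (j == r) && (r < i)%N then reduced C r i *m mpinv (reduced C r j)
     else 0).

(* The factor with the largest index is leftmost. *)
Definition elim_prod C : 'M[K]_(\sum_i h i) :=
  \big[mulmx/1%:M]_(r <- rev (enum 'I_q) | (r.+1 < q)%N) elim_mx C r.

Definition gram_block C r : 'M[K]_(h r) := pivot C r *m (pivot C r)^t*.

Definition gram_diag C : 'M[K]_(\sum_i h i) := \mxdiag_r gram_block C r.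

Definition gram_diag_pinv C : 'M[K]_(\sum_i h i) :=
  \mxdiag_r mpinv (gram_block C r).

Lemma gram_diag_pinvE C : gram_diag_pinv C = mpinv (gram_diag C).
Proof.
have dM (B D : forall i, 'M[K]_(h i)) :
    mxdiag B *m mxdiag D = \mxdiag_i (B i *m D i).
  rewrite {2}/mxdiag mul_mxdiag_mxblock; apply/eq_mxblock => i j.
  by case: eqP => [e|]; [case: _ / e; rewrite !conform_mx_id | rewrite mulmx0].
have dA (B : forall i, 'M[K]_(h i)) : (mxdiag B)^t* = \mxdiag_i (B i)^t*.
  have -> : (mxdiag B)^t* = \mxblock_(i, j)
      map_mx Num.conj (if j == i then conform_mx 0 (B j) else 0)^T.
    by rewrite tr_mxblock; apply/matrixP => i j; rewrite !mxE.
  apply/eq_mxblock => i j; rewrite eq_sym.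
  by case: eqP => [e|]; [case: _ / e; rewrite !conform_mx_id
                        | rewrite trmx0 map_mx0].
apply: (@penrose_uniq _ _ _ (gram_diag C)); last exact: mpinvP.
rewrite /gram_diag_pinv /gram_diag /penrose !dM !dA.
by apply/and4P; split; apply/eqP/eq_mxdiag => i;
   have /and4P[/eqP ? /eqP ? /eqP ? /eqP ?] := mpinvP (gram_block C i).
Qed.

End BlockReduction.

(* Main.v *)
(* The reduction makes the pivots mutually orthogonal, so P = F C satisfies
   P P^* = D_C, and Y_+ C = A Q with Q = P^* (P P^* )^+ P.  Every row of C is a
   combination of pivot rows, which Q^* fixes; hence Q C^* = C^*, which is the
   normal equation.  Minimality is then Pythagoras for the Frobenius norm. *)
Require Import Defs.

Import Order.TTheory GRing.Theory Num.Theory.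
Local Open Scope ring_scope.
Local Open Scope sesquilinear_scope.

Section Gram.
Variable K : numClosedFieldType.

(** With Z = X - Y the hypothesis gives (Z P)(Z P)^* = 0, which forces Z P = 0. *)
Lemma mulmx_ctrmx_inj m n p (P : 'M[K]_(m, n)) (X Y : 'M[K]_(p, m)) :
  X *m (P *m P^t*) = Y *m (P *m P^t*) -> X *m P = Y *m P.
Proof.
move=> /eqP; rewrite -subr_eq0 -mulmxBl => /eqP XY.
apply/eqP; rewrite -subr_eq0 -mulmxBl -mulmx_ctrmx_eq0 ctrmx_mul.
by rewrite mulmxA -(mulmxA _ P) XY mul0mx.
Qed.

(** By [mulmx_ctrmx_inj] it is enough to check D (D^+)^* D = D for the Gram matrix D of P. Since D
    is Hermitian, this is the adjoint of D D^+ D = D. *)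
Lemma gram_mpinv_id m n (P : 'M[K]_(m, n)) :
  P *m (P^t* *m mpinv (P *m P^t*) *m P)^t* = P.
Proof.
set D := P *m P^t*; have DH : D^t* = D by rewrite ctrmx_mul trmxCK.
have /and4P[/eqP DXD _ _ _] := mpinvP D.
rewrite !ctrmx_mul trmxCK !mulmxA -[RHS]mul1mx.
apply: mulmx_ctrmx_inj; rewrite -/D mul1mx.
move: D DH DXD => {P} D DH DXD.
by rewrite -[RHS]DH -[in RHS]DXD !ctrmx_mul DH mulmxA.
Qed.

Lemma frobenius_trace m n (M : 'M[K]_(m, n)) :
  frobenius M = sqrtC (\tr (M *m M^t*)).
Proof.
congr sqrtC; apply: eq_bigr => i _; rewrite !mxE.
by apply: eq_bigr => j _; rewrite !mxE normCK.
Qed.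

Lemma trace_gram_ge0 m n (M : 'M[K]_(m, n)) : 0 <= \tr (M *m M^t*).
Proof.
apply: sumr_ge0 => i _; rewrite mxE; apply: sumr_ge0 => j _.
by rewrite !mxE mul_conjC_ge0.
Qed.

Lemma frobenius_min m n p (A : 'M[K]_(m, n)) (C : 'M[K]_(p, n))
    (Y Z : 'M[K]_(m, p)) :
  Y *m C *m C^t* = A *m C^t* -> frobenius (A - Y *m C) <= frobenius (A - Z *m C).
Proof.
move=> normal_eq; set E := A - Y *m C; set G := (Y - Z) *m C.
have -> : A - Z *m C = E + G by rewrite /G mulmxBl addrA subrK.
(* The normal equation says E C^* = 0, and the rows of G lie in the row space of C. *)
have EG : E *m G^t* = 0.
  by rewrite ctrmx_mul mulmxA mulmxBl normal_eq subrr mul0mx.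
have GE : G *m E^t* = 0.
  by rewrite -[G]trmxCK -ctrmx_mul EG trmx0 map_mx0.
move: E G EG GE => {A C Y Z normal_eq} E G EG GE.
rewrite !frobenius_trace ler_sqrtC ?nnegrE ?trace_gram_ge0 //.
have -> : (E + G)^t* = E^t* + G^t* by rewrite raddfD map_mxD.
rewrite mulmxDl !mulmxDr EG GE addr0 add0r mxtraceD.
by rewrite lerDl trace_gram_ge0.
Qed.

End Gram.

Section Reduction.
Variables (K : numClosedFieldType) (n q : nat) (h : 'I_q -> nat).
Variable C : forall j, 'M[K]_(h j, n).

Lemma reducedS (r j : 'I_q) :
  reduced C r.+1 j =
    if (r < j)%N then reduced C r j *m (1%:M - mpinv (pivot C r) *m pivot C r)
    else reduced C r j.
Proof. by rewrite /= valK. Qed.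

(** The step with pivot k alters only blocks after k, so block j is final from stage j on. *)
Lemma reduced_pivot k (j : 'I_q) : (j <= k <= q)%N -> reduced C k j = pivot C j.
Proof.
elim: k => [|k IHk] /andP[jk kq].
  by rewrite /pivot; move: jk; rewrite leqn0 => /eqP ->.
move: jk; rewrite leq_eqVlt => /predU1P[<- //|jk].
by rewrite (reducedS (Ordinal kq)) /= ltnNge -ltnS jk /= IHk // -ltnS jk ltnW.
Qed.

Lemma reduced_orthogonal k (r j : 'I_q) :
  (r < k <= q)%N -> (r < j)%N -> reduced C k j *m (pivot C r)^t* = 0.
Proof.
elim: k j => // k IHk j /andP[rk kq] rj.
rewrite (reducedS (Ordinal kq)) /=.
move: rk; rewrite ltnS leq_eqVlt => /predU1P[rk|rk]; last first.
  (* Step k > r preserves orthogonality: pivot k is already orthogonal to pivot r, so I - P_k^+ P_k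
     fixes P_r^*. *)
  have IH (i : 'I_q) : (r < i)%N -> reduced C k i *m (pivot C r)^t* = 0.
    by apply: IHk; rewrite rk ltnW.
  case: ifP => _; last exact: IH.
  by rewrite -mulmxA mulmxBl mul1mx -mulmxA (IH (Ordinal kq)) // mulmx0 subr0 IH.
(* Step r creates orthogonality: P_r^+ P_r is Hermitian, so P_r^+ P_r P_r^* = (P_r P_r^+ P_r)^* =
   P_r^*. *)
have -> : Ordinal kq = r by apply: val_inj.
have /and4P[/eqP PXP _ _ /eqP XPH] := mpinvP (pivot C r).
rewrite -rk rj -mulmxA mulmxBl mul1mx -[in X in _ - X]XPH -ctrmx_mul mulmxA PXP.
by rewrite subrr mulmx0.
Qed.

Lemma pivot_orthogonal (i j : 'I_q) :
  i != j -> pivot C i *m (pivot C j)^t* = 0.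
Proof.
have lt_orth (r s : 'I_q) : (r < s)%N -> pivot C s *m (pivot C r)^t* = 0.
  move=> rs; have rsq : (r < s <= q)%N by rewrite rs ltnW.
  exact: reduced_orthogonal rsq rs.
rewrite neq_ltn => /orP[ij|]; last exact: lt_orth.
by rewrite -[LHS]trmxCK ctrmx_mul trmxCK lt_orth // trmx0 map_mx0.
Qed.

Lemma gram_mxcol_pivot :
  (\mxcol_j pivot C j) *m (\mxcol_j pivot C j)^t* = gram_diag C.
Proof.
have -> : (\mxcol_j pivot C j)^t* = \mxrow_j (pivot C j)^t*.
  by rewrite tr_mxcol; apply/matrixP => i j; rewrite !mxE.
rewrite mul_mxcol_mxrow; apply/eq_mxblock => i j.
case: eqP => [e|/eqP]; last exact: pivot_orthogonal.
by case: _ / e; rewrite conform_mx_id.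
Qed.

Lemma mul_elim_mx (r : 'I_q) :
  elim_mx C r *m (\mxcol_j reduced C r j) = \mxcol_j reduced C r.+1 j.
Proof.
rewrite mulmxBl mul1mx mul_mxblock_mxrow -mxcolB; apply/eq_mxcol => j.
rewrite reducedS (bigD1 r) //= eqxx big1 ?addr0 => [|i /negPf ->]; last first.
  by rewrite mul0mx.
by case: ltnP => _; rewrite ?mul0mx ?subr0 // mulmxBr mulmx1 !mulmxA.
Qed.

(** After reversal, index r comes first, so the newest elimination factor can be split off on the
    left. *)
Lemma filter_enum_ord_ltnS (r : 'I_q) :
  [seq i : 'I_q <- enum 'I_q | (i < r.+1)%N] =
    rcons [seq i : 'I_q <- enum 'I_q | (i < r)%N] r.
Proof.
apply: (inj_map val_inj); rewrite map_rcons.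
have E k : (k <= q)%N ->
    map val [seq i : 'I_q <- enum 'I_q | (i < k)%N] = iota 0 k.
  move=> kq; rewrite -(filter_map val (fun i => i < k)%N) val_enum_ord.
  exact: (@filter_iota_ltn 0).
by rewrite !E ?(ltnW (ltn_ord r)) // -addn1 iotaD cats1.
Qed.

Lemma mul_elim_prod_reduced k : (k <= q)%N ->
  (\big[mulmx/1%:M]_(r <- rev (enum 'I_q) | (r < k)%N) elim_mx C r)
    *m (\mxcol_j C j) = \mxcol_j reduced C k j.
Proof.
elim: k => [|k IHk] kq; first by rewrite [X in X *m _]big_pred0 ?mul1mx.
rewrite -[X in X *m _]big_filter filter_rev (filter_enum_ord_ltnS (Ordinal kq)).
rewrite rev_rcons [X in X *m _]big_cons -filter_rev.
rewrite [X in _ *m X *m _]big_filter -mulmxA IHk ?(ltnW kq) //.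
exact: (mul_elim_mx (Ordinal kq)).
Qed.

Lemma mul_elim_prod : elim_prod C *m (\mxcol_j C j) = \mxcol_j pivot C j.
Proof.
(* F stops at stage q - 1, which is enough: the last block is a pivot without being reduced by
   itself. *)
have -> : elim_prod C =
    \big[mulmx/1%:M]_(r <- rev (enum 'I_q) | (r < q.-1)%N) elim_mx C r.
  by apply: eq_bigl => r; rewrite ltn_predRL.
rewrite mul_elim_prod_reduced ?leq_pred //; apply/eq_mxcol => j.
by rewrite reduced_pivot // leq_pred andbT -ltnS (ltn_predK (ltn_ord j)).
Qed.

(* Reading the reduction backwards, each block is a left combination of
   pivots. *)
Lemma pivot_fixed p (Q Q' : 'M[K]_(n, p)) :
  (forall r, pivot C r *m Q = pivot C r *m Q') ->
  forall j, C j *m Q = C j *m Q'.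
Proof.
move=> PQ.
(* Induction descends from stage q, where every block is a pivot, to stage 0, which is C. *)
suff red k : (k <= q)%N ->
    forall j, reduced C (q - k) j *m Q = reduced C (q - k) j *m Q'.
  by move: (red q); rewrite subnn; apply.
elim: k => [_ j|k IHk kq j].
  by rewrite subn0 reduced_pivot ?PQ // leqnn ltnW.
have rq : (q - k.+1 < q)%N by rewrite ltn_subrL (leq_ltn_trans _ kq).
have := IHk (ltnW kq) j; rewrite -subSS subSn // (reducedS (Ordinal rq)) /=.
case: ifP => // _; rewrite mulmxBr mulmx1 !mulmxBl !mulmxA.
(* The subtracted term ends in a pivot, so it agrees on Q and Q' and cancels. *)
by rewrite -!(mulmxA _ (pivot _ _)) PQ => /addIr.
Qed.

End Reduction.

Theorem theorem2 (R : realType) (m n q : nat) (h : 'I_q -> nat)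
    (A : 'M[R[i]]_(m, n)) (C_ : forall j : 'I_q, 'M[R[i]]_(h j, n)) :
  let C := \mxcol_j C_ j in
  let F := elim_prod C_ in
  let Y_plus := A *m C^t* *m F^t* *m gram_diag_pinv C_ *m F in
  Y_plus *m C *m C^t* = A *m C^t* /\
  forall Y : 'M[R[i]]_(m, \sum_j h j),
    frobenius (A - Y_plus *m C) <= frobenius (A - Y *m C).
Proof.
move=> C F Y_plus.
suff normal_eq : Y_plus *m C *m C^t* = A *m C^t*.
  by split=> // Y; apply: frobenius_min.
pose P := \mxcol_j pivot C_ j; have FC : F *m C = P by exact: mul_elim_prod.
pose Q := P^t* *m mpinv (P *m P^t*) *m P.
have CQ : C *m Q^t* = C.
  (* Writing C as C I lets [pivot_fixed] compare Q^* with the identity. *)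
  rewrite -[RHS]mulmx1 !mxcol_mul; apply/eq_mxcol; apply: pivot_fixed => r.
  have := gram_mpinv_id _ _ _ P; rewrite -/Q -[RHS]mulmx1 !mxcol_mul.
  by move=> /eq_mxcolP/(_ r).
have -> : Y_plus *m C = A *m Q.
  rewrite /Y_plus gram_diag_pinvE -gram_mxcol_pivot -/P.
  (* C^* F^* = (F C)^* = P^*. *)
  by rewrite -(mulmxA A) -ctrmx_mul FC -(mulmxA _ F) FC /Q !mulmxA.
by rewrite -mulmxA -[Q]trmxCK -ctrmx_mul CQ.
Qed.
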